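(* Fix $\mathbf k\in\mathbb R^2$ and consider $\lambda\in\mathbb R$ with $\lambda\ne\eta_\ell^2$ for $\ell=1,\dots,L$. The nonlinear eigenvalue problem $$(\mathrm N)\qquad \mathcal A_{\mathbf k}u+\Xi\,\mathcal I_2u=\lambda\,\mathcal I_\alpha u+\mathbf b^*(\mathbf A-\lambda\mathbf I)^{-1}\mathbf b\;\mathcal I_2u\quad\text{in }V^*,\qquad u\in V\setminus\{0\},$$ and the linear eigenvalue problem $$(\mathrm L)\qquad \begin{bmatrix}\mathcal A_{\mathbf k}+\Xi\,\mathcal I_2&-\overline{\mathcal I}_2\mathbf b^*\\-\mathbf b\,\overline{\mathcal I}_2^*&\mathbf A\,j_X\end{bmatrix}\mathbf z=\lambda\begin{bmatrix}\mathcal I_\alpha&0\\0&\mathbf I\,j_X\end{bmatrix}\mathbf z\quad\text{in }V^*\times(X^L)^*,\qquad \mathbf z\in (V\times X^L)\setminus\{0\},$$ are equivalent: if $(u,\lambda)$ is an eigenpair of $(\mathrm N)$, then $([u;\mathbf x],\lambda)$ with $\mathbf x:=(\mathbf A-\lambda\mathbf I)^{-1}\mathbf b\,j_X^{-1}\overline{\mathcal I}_2^*u\in X^L$ is an eigenpair of $(\mathrm L)$; conversely, if $([u;\mathbf x],\lambda)$ is an eigenpair of $(\mathrm L)$, then $\mathbf x$ is given by this formula and $(u,\lambda)$ is an eigenpair of $(\mathrm N)$.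
   Context: Setting: $\Omega\subset\mathbb R^2$ is a bounded domain (Wigner–Seitz cell of a periodic lattice), decomposed into disjoint subdomains $\Omega=\Omega_1\cup\Omega_2$ with indicator functions $\chi_1,\chi_2$. Constants $\alpha_1,\alpha_2>0$ and real $\xi_\ell,\eta_\ell$ ($\ell=1,\dots,L$) are given; $\Xi:=\sum_\ell\xi_\ell^2$, $\mathbf b:=[\xi_1\eta_1,\dots,\xi_L\eta_L]^T\in\mathbb R^L$, $\mathbf A:=\mathrm{diag}(\eta_1^2,\dots,\eta_L^2)$, $\mathbf I$ the $L\times L$ identity. Spaces: $V:=H^1_{\rm per}(\Omega)$; $X:=\{v\in L^2(\Omega): v=0\text{ on }\Omega_1\}$ with $(u,v)_X:=\int_{\Omega_2}u\overline v\,dx$. Stars on spaces denote conjugate duals; $j_X\colon X\to X^*$ is the Riesz isomorphism $\langle j_Xu,v\rangle=(u,v)_X$, applied componentwise on $X^L$. Operators: $\nabla_{\mathbf k}:=\nabla+i\mathbf k$; $\mathcal A_{\mathbf k},\mathcal I_1,\mathcal I_2,\mathcal I_\alpha\colon V\to V^*$ with $\langle\mathcal A_{\mathbf k}u,v\rangle:=\int_\Omega\nabla_{\mathbf k}u\cdot\overline{\nabla_{\mathbf k}v}\,dx$, $\langle\mathcal I_ju,v\rangle:=\int_{\Omega_j}u\overline v\,dx$, $\mathcal I_\alpha:=\alpha_1\mathcal I_1+\alpha_2\mathcal I_2$; $\overline{\mathcal I}_2\colon X\to V^*$ with $\langle\overline{\mathcal I}_2u,v\rangle:=\int_{\Omega_2}u\overline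 v\,dx$; $\overline{\mathcal I}_2^*\colon V\to X^*$ with $\langle\overline{\mathcal I}_2^*v,u\rangle:=(\chi_2v,u)_X$. Here $\mathbf b^*\mathbf x=\sum_\ell\xi_\ell\eta_\ell x_\ell\in X$ for $\mathbf x\in X^L$, and $\mathbf b\,\overline{\mathcal I}_2^*u=[\xi_\ell\eta_\ell\overline{\mathcal I}_2^*u]_{\ell=1}^L$. *)

(* Defs.v *)
From HB Require Import structures.
From mathcomp Require Import all_boot all_order all_algebra.
From mathcomp Require Import complex.
From mathcomp Require Import all_classical all_reals all_analysis.
Import Order.TTheory GRing.Theory Num.Theory.
Import numFieldNormedType.Exports.

Set Implicit Arguments.
Unset Strict Implicit.
Unset Printing Implicit Defensive.

Local Open Scope classical_set_scope.
Local Open Scope ring_scope.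
Local Open Scope complex_scope.

Section Spaces.
Variable R : realType.

(* R^2 with the Borel sigma-algebra carried by the library's Lebesgue measure;
   the underlying type is R * R. *)
Definition plane := (measurableTypeR R * measurableTypeR R)%type.

Definition leb2 : {measure set plane -> \bar R} :=
  (@lebesgue_measure R \x @lebesgue_measure R)%E.

(* Complex-valued functions on R^2, as representatives: elements of L^2(D) are
   such functions, considered up to equality almost everywhere on D (their
   values outside D are irrelevant). The regular module R[i]^o makes [fn] a
   complex vector space with pointwise operations. *)
Definition fn := R * R -> R[i]^o.

(* Elements of a conjugate dual W^*, W a set of functions: only the values on
   W are meaningful, see [eq_dual]. *)
Definition functional := fn -> R[i]^o.

Definition eq_dual (W : set fn) (F G : functional) :=
  forall v, W v -> F v = G v.

Definition cintegral (D : set (R * R)) (f : fn) : R[i] :=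
  Rintegral leb2 D (fun x => complex.Re (f x)) +i*
  Rintegral leb2 D (fun x => complex.Im (f x)).

Definition L2 (D : set (R * R)) : set fn := fun f =>
  [/\ measurable_fun (D : set plane) (fun x => complex.Re (f x) : R),
      measurable_fun (D : set plane) (fun x => complex.Im (f x) : R) &
      leb2.-integrable D
        (fun x => (complex.Re (f x) ^+ 2 + complex.Im (f x) ^+ 2)%:E)].

Definition L2loc : set fn := [set f : fn | forall K, compact K -> L2 K f].

Definition e1 : R * R := (1, 0).
Definition e2 : R * R := (0, 1).

(* Real C^oo functions on R^2: every iterated directional derivative is
   differentiable everywhere. *)
Definition smooth (phi : R * R -> R) :=
  forall (s : seq (R * R)) (x : R * R),
    differentiable (foldr (fun (w : R * R) (f : R * R -> R) => 'D_w f) phi s) x.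

Definition test_function (phi : R * R -> R) :=
  smooth phi /\ compact (closure [set x | phi x != 0]).

Definition weak_gradient (u : fn) (g : fn * fn) :=
  forall phi, test_function phi ->
    cintegral setT (fun x => u x * ('D_e1 phi x)%:C) =
      - cintegral setT (fun x => g.1 x * (phi x)%:C) /\
    cintegral setT (fun x => u x * ('D_e2 phi x)%:C) =
      - cintegral setT (fun x => g.2 x * (phi x)%:C).

Section Lattice.
Variables a1 a2 : R * R.

Definition lattice : set (R * R) :=
  [set r | exists m n : int, r = a1 *~ m + a2 *~ n].

(* The norm of R * R in the library is the sup norm. *)
Definition sqnorm (x : R * R) : R := x.1 ^+ 2 + x.2 ^+ 2.

Definition wigner_seitz : set (R * R) :=
  [set x | forall r, lattice r -> r != 0 -> sqnorm x < sqnorm (x - r)].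

Definition lattice_periodic (f : fn) := forall r x, lattice r -> f (x + r) = f x.

Let Omega := wigner_seitz.

(* [g] is the gradient on Omega of [u]: it is the weak gradient on R^2 of a
   periodic extension of [u]. *)
Definition per_gradient (u : fn) (g : fn * fn) :=
  exists U : fn,
    [/\ lattice_periodic U, ae_eq leb2 Omega u U, L2loc U,
        L2loc g.1 /\ L2loc g.2 & weak_gradient U g].

(* H^1_per(Omega): functions on Omega whose periodic extension to R^2 is in
   H^1_loc(R^2) *)
Definition H1per : set fn :=
  [set u | L2 Omega u /\ exists g, per_gradient u g].

(* For u in H1per such a gradient exists and is unique almost everywhere. *)
Definition grad (u : fn) : fn * fn :=
  xget (0, 0) [set g | per_gradient u g].

Definition kgrad (k : R * R) (u : fn) : fn * fn :=
  ((grad u).1 + ('i * k.1%:C) *: u, (grad u).2 + ('i * k.2%:C) *: u).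

Definition opA (k : R * R) (u : fn) : functional := fun v =>
  cintegral Omega (fun x => (kgrad k u).1 x * ((kgrad k v).1 x)^* +
                            (kgrad k u).2 x * ((kgrad k v).2 x)^*).

Section Subdomains.
Variables Omega1 Omega2 : set (R * R).

Definition Xspace : set fn :=
  [set v | L2 Omega v /\ ae_eq leb2 Omega1 v (0 : fn)].

Definition Xprod (u v : fn) : R[i] :=
  cintegral Omega2 (fun x => u x * (v x)^*).

(* I_j, with D = Omega_j *)
Definition opI (D : set (R * R)) (u : fn) : functional := fun v =>
  cintegral D (fun x => u x * (v x)^*).

Definition opIalpha (alpha1 alpha2 : R) (u : fn) : functional :=
  alpha1%:C *: opI Omega1 u + alpha2%:C *: opI Omega2 u.

Definition opIbar (u : fn) : functional := fun v =>
  cintegral Omega2 (fun x => u x * (v x)^*).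

Definition opIbar_adj (v : fn) : functional := fun u =>
  Xprod (fun x => (\1_Omega2 x : R)%:C * v x) u.

Definition jX (u : fn) : functional := fun v => Xprod u v.

(* The inverse of jX: for F in X^*, a representative w in X of the unique (almost
   everywhere) solution of jX w = F in X^*, which exists by the Riesz theorem. *)
Definition jXinv (F : functional) : fn :=
  xget 0 [set w | Xspace w /\ eq_dual Xspace (jX w) F].

End Subdomains.
End Lattice.

(* Action of a real p x q matrix on E^q, E a complex vector space *)
Definition mxact (E : lmodType R[i]) (p q : nat) (M : 'M[R]_(p, q))
    (x : 'I_q -> E) : 'I_p -> E :=
  fun i => \sum_(j < q) (M i j)%:C *: x j.

Section Problems.
Variables (a1 a2 : R * R) (Omega1 Omega2 : set (R * R)) (alpha1 alpha2 : R).
Variables (L : nat) (xi eta : 'I_L -> R) (k : R * R).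

Let V := H1per a1 a2.
Let X := Xspace a1 a2 Omega1.
Let Ak := opA a1 a2 k.
Let I2 := opI Omega2.
Let Ialpha := opIalpha Omega1 Omega2 alpha1 alpha2.
Let Ibar2 := opIbar Omega2.
Let Ibar2_adj := opIbar_adj Omega2.

Definition Xi : R := \sum_(l < L) xi l ^+ 2.
Definition bvec : 'cV[R]_L := \col_l (xi l * eta l).
Definition Amx : 'M[R]_L := diag_mx (\row_l eta l ^+ 2).

Definition bstar (x : 'I_L -> fn) : fn := mxact bvec^T x ord0.
Definition bmul (E : lmodType R[i]) (w : E) : 'I_L -> E :=
  mxact bvec (fun _ : 'I_1 => w).

(* b^* (A - lambda I)^-1 b *)
Definition rational_coef (lam : R) : R :=
  (bvec^T *m invmx (Amx - lam%:M) *m bvec) 0 0.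

Definition eigenpairN (u : fn) (lam : R) :=
  [/\ V u, ~ ae_eq leb2 (wigner_seitz a1 a2) u (0 : fn) &
      eq_dual V (Ak u + Xi%:C *: I2 u)
                (lam%:C *: Ialpha u + (rational_coef lam)%:C *: I2 u)].

(* The two sides of (L), as elements of V^* x (X^L)^*, where (X^L)^* is
   identified with (X^* )^L componentwise *)
Definition blockL (z : fn * ('I_L -> fn)) : functional * ('I_L -> functional) :=
  (Ak z.1 + Xi%:C *: I2 z.1 - Ibar2 (bstar z.2),
   - bmul (Ibar2_adj z.1) + mxact Amx (fun l => jX Omega2 (z.2 l))).

Definition massL (z : fn * ('I_L -> fn)) : functional * ('I_L -> functional) :=
  (Ialpha z.1, mxact 1%:M (fun l => jX Omega2 (z.2 l))).

Definition eigenpairL (z : fn * ('I_L -> fn)) (lam : R) :=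
  [/\ V z.1 /\ (forall l, X (z.2 l)),
      ~ (ae_eq leb2 (wigner_seitz a1 a2) z.1 (0 : fn) /\
         forall l, ae_eq leb2 (wigner_seitz a1 a2) (z.2 l) (0 : fn)),
      eq_dual V (blockL z).1 (lam%:C *: (massL z).1) &
      forall l, eq_dual X ((blockL z).2 l) (lam%:C *: (massL z).2 l)].

(* (A - lambda I)^-1 b j_X^-1 Ibar2^* u *)
Definition xformula (lam : R) (u : fn) : 'I_L -> fn :=
  mxact (invmx (Amx - lam%:M))
    (bmul (jXinv a1 a2 Omega1 Omega2 (Ibar2_adj u))).

End Problems.
End Spaces.

(* Main.v *)
(** Since [jX] is the scalar product of [L^2(Omega_2)], the function
[w = jX^-1 Ibar_2^* u] is [chi_2 u], so [I_2 w = I_2 u], and row [l] of the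
second equation of (L) reads
[(eta_l^2 - lam) (x_l, v)_X = xi_l eta_l (w, v)_X] for all [v] in [X], which
says [x_l = xi_l eta_l / (eta_l^2 - lam) w]. Substituting this in [Ibar_2 b^* x]
turns the first equation of (L) into (N). *)

Require Import Defs.
From mathcomp Require Import all_boot all_order all_algebra.
From mathcomp Require Import complex.
From mathcomp Require Import all_classical all_reals all_analysis.
From mathcomp Require Import measurable_realfun ring lra.
Import Order.TTheory GRing.Theory Num.Theory.
Import numFieldNormedType.Exports.
Local Open Scope classical_set_scope.
Local Open Scope ring_scope.

Set Implicit Arguments.
Unset Strict Implicit.

(** * Square-integrable functions and the forms [opI D] on them *)

Section L2.
Variable R : realType.
Implicit Types (D E : set (plane R)) (f g v : fn R) (c : R).

Lemma L2_subset D E f : measurable D -> measurable E -> E `<=` D ->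
  L2 D f -> L2 E f.
Proof.
move=> mD mE sED [mr mi int]; split.
- exact: measurable_funS mr.
- exact: measurable_funS mi.
- exact: integrableS int.
Qed.

(** Both parts of the integrand are dominated by |f|^2 + |g|^2. The linearity of [opI] in its first
    argument rests on this. *)
Lemma L2_mulc_integrable D f g : measurable D -> L2 D f -> L2 D g ->
  (leb2 R).-integrable D (EFin \o (fun x => complex.Re (f x * (g x)^*)%C)) /\
  (leb2 R).-integrable D (EFin \o (fun x => complex.Im (f x * (g x)^*)%C)).
Proof.
move=> mD [mrf mif intf] [mrg mig intg].
have dom (h : plane R -> R) : measurable_fun D h ->
    (forall x, `|h x| <= complex.Re (f x) ^+ 2 + complex.Im (f x) ^+ 2 +
      (complex.Re (g x) ^+ 2 + complex.Im (g x) ^+ 2)) ->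
    (leb2 R).-integrable D (EFin \o h).
  move=> mh le; apply: (le_integrable mD _ _ (integrableD mD intf intg)).
    exact/measurable_EFinP.
  move=> x _ /=; rewrite lee_fin.
  by rewrite (le_trans (le x))// ler_norm.
split.
- rewrite (_ : (fun x => _) = fun x => complex.Re (f x) * complex.Re (g x) +
      complex.Im (f x) * complex.Im (g x)); last first.
    by apply/funext => x; case: (f x) (g x) => [a b] [p q] /=; ring.
  apply: dom.
    by apply: measurable_funD; apply: measurable_funM.
  move=> x; rewrite ler_norml; case: (f x) (g x) => [a b] [p q] /=.
  (* These squares give 2|ap| <= a^2 + p^2 and 2|bq| <= b^2 + q^2. *)
  have := (sqr_ge0 (a + p), sqr_ge0 (a - p), sqr_ge0 (b + q), sqr_ge0 (b - q)).
  have := (sqr_ge0 a, sqr_ge0 b, sqr_ge0 p, sqr_ge0 q).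
  by case=> [[[? ?] ?] ?] [[[? ?] ?] ?]; apply/andP; split; nra.
- rewrite (_ : (fun x => _) = fun x => complex.Im (f x) * complex.Re (g x) -
      complex.Re (f x) * complex.Im (g x)); last first.
    by apply/funext => x; case: (f x) (g x) => [a b] [p q] /=; ring.
  apply: dom.
    by apply: measurable_funB; apply: measurable_funM.
  move=> x; rewrite ler_norml; case: (f x) (g x) => [a b] [p q] /=.
  have := (sqr_ge0 (b + p), sqr_ge0 (b - p), sqr_ge0 (a + q), sqr_ge0 (a - q)).
  have := (sqr_ge0 a, sqr_ge0 b, sqr_ge0 p, sqr_ge0 q).
  by case=> [[[? ?] ?] ?] [[[? ?] ?] ?]; apply/andP; split; nra.
Qed.

Lemma L2Z D c f : measurable D -> L2 D f -> L2 D (c%:C%C *: f).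
Proof.
move=> mD [mr mi int].
have ReZ x : complex.Re ((c%:C%C *: f) x) = c * complex.Re (f x).
  by rewrite fctE; case: (f x) => a b /=; ring.
have ImZ x : complex.Im ((c%:C%C *: f) x) = c * complex.Im (f x).
  by rewrite fctE; case: (f x) => a b /=; ring.
split.
- by under eq_fun do rewrite ReZ; apply: measurable_funM.
- by under eq_fun do rewrite ImZ; apply: measurable_funM.
- apply: eq_integrable (integrableZl mD (c ^+ 2) int) => //= x _.
  by rewrite ReZ ImZ -EFinM; congr EFin; ring.
Qed.

Lemma L2D D f g : measurable D -> L2 D f -> L2 D g -> L2 D (f + g).
Proof.
move=> mD [mrf mif intf] [mrg mig intg].
have ReD x : complex.Re ((f + g) x) = complex.Re (f x) + complex.Re (g x).
  by rewrite fctE; case: (f x) (g x) => a b [].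
have ImD x : complex.Im ((f + g) x) = complex.Im (f x) + complex.Im (g x).
  by rewrite fctE; case: (f x) (g x) => a b [].
have mr : measurable_fun D (fun x => complex.Re ((f + g) x)).
  by under eq_fun do rewrite ReD; apply: measurable_funD.
have mi : measurable_fun D (fun x => complex.Im ((f + g) x)).
  by under eq_fun do rewrite ImD; apply: measurable_funD.
split => //.
(* The factor 2 comes from |f + g|^2 <= 2 (|f|^2 + |g|^2), a form of |f - g|^2 >= 0. *)
apply: (le_integrable mD _ _ (integrableZl mD 2 (integrableD mD intf intg))).
  apply/measurable_EFinP.
  by apply: measurable_funD; apply: measurable_funX.
move=> x _ /=; rewrite lee_fin ReD ImD.
case: (f x) (g x) => [a b] [p q] /=; rewrite !ger0_norm; last 2 first.
- by rewrite mulr_ge0// !addr_ge0// sqr_ge0.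
- by rewrite addr_ge0// sqr_ge0.
by have := (sqr_ge0 (a - p), sqr_ge0 (b - q)); case=> ? ?; nra.
Qed.

Lemma opI_ae_eq D f g : measurable D -> ae_eq (leb2 R) D f g ->
  L2 D f -> L2 D g -> forall v, L2 D v -> opI D f v = opI D g v.
Proof.
move=> mD fg f2 g2 v v2.
have [/integrableP[mrf _] /integrableP[mif _]] := L2_mulc_integrable mD f2 v2.
have [/integrableP[mrg _] /integrableP[mig _]] := L2_mulc_integrable mD g2 v2.
rewrite /opI /cintegral; congr (_ +i* _)%C; rewrite /Rintegral; congr fine;
  apply: ae_eq_integral => //; apply: filterS fg => x /= h Dx; by rewrite h.
Qed.

(** Real scalars suffice: those met in eliminating x are all real. *)
Lemma opIZ D c f v : measurable D -> L2 D f -> L2 D v ->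
  opI D (c%:C%C *: f) v = c%:C%C * opI D f v.
Proof.
move=> mD f2 v2; have [ir ii] := L2_mulc_integrable mD f2 v2.
transitivity ((c * Rintegral (leb2 R) D (fun x => complex.Re (f x * (v x)^*)%C)) +i*
   (c * Rintegral (leb2 R) D (fun x => complex.Im (f x * (v x)^*)%C)))%C; last first.
  by rewrite /opI /cintegral; apply/eqP; rewrite eq_complex /=; apply/andP; split; apply/eqP; ring.
rewrite -!RintegralZl// /opI /cintegral; congr (_ +i* _)%C; apply: eq_Rintegral => x _.
all: by rewrite fctE; case: (f x) (v x) => a b [p q] /=; ring.
Qed.

Lemma opID D f g v : measurable D -> L2 D f -> L2 D g -> L2 D v ->
  opI D (f + g) v = opI D f v + opI D g v.
Proof.
move=> mD f2 g2 v2.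
have [irf iif] := L2_mulc_integrable mD f2 v2.
have [irg iig] := L2_mulc_integrable mD g2 v2.
transitivity ((Rintegral (leb2 R) D (fun x => complex.Re (f x * (v x)^*)%C) +
      Rintegral (leb2 R) D (fun x => complex.Re (g x * (v x)^*)%C)) +i*
   (Rintegral (leb2 R) D (fun x => complex.Im (f x * (v x)^*)%C) +
      Rintegral (leb2 R) D (fun x => complex.Im (g x * (v x)^*)%C)))%C; last by [].
rewrite -!RintegralD// /opI /cintegral; congr (_ +i* _)%C; apply: eq_Rintegral => x _.
all: by rewrite fctE; case: (f x) (g x) (v x) => a b [s t] [p q] /=; ring.
Qed.

(** The integrand is |f|^2 >= 0, so a zero integral makes it vanish almost everywhere. *)
Lemma opI_self_eq0 D f : measurable D -> L2 D f -> opI D f f = 0 ->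
  ae_eq (leb2 R) D f (0 : fn R).
Proof.
move=> mD [mr mi int] /(congr1 (@complex.Re R)) /=.
rewrite /Rintegral.
have -> : (fun x => ((complex.Re (f x * (f x)^*%C))%:E)) =
    fun x => (complex.Re (f x) ^+ 2 + complex.Im (f x) ^+ 2)%:E.
  by apply/funext => x; case: (f x) => a b /=; congr EFin; ring.
(* Since [fine] also sends infinite values to 0, finiteness of the integral is needed to conclude
   that it is 0. *)
move=> /eqP; rewrite fine_eq0 ?integrable_fin_num// => /eqP I0.
have /integrableP[mf _] := int.
have := (ae_eq_integral_abs (leb2 R) mD mf).1.
have -> : (\int[leb2 R]_(x in D)
    `|(complex.Re (f x) ^+ 2 + complex.Im (f x) ^+ 2)%:E|)%E = 0.
  rewrite -I0; apply: eq_integral => x _ /=.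
  by rewrite ger0_norm// addr_ge0 ?sqr_ge0.
move=> /(_ erefl); apply: filterS => x /= H Dx.
have := H Dx => -[] /eqP; rewrite paddr_eq0 ?sqr_ge0// !sqrf_eq0.
by case: (f x) => a b /= /andP[/eqP -> /eqP ->].
Qed.

Lemma opI_eq D f g v : {in D, f =1 g} -> opI D f v = opI D g v.
Proof.
by move=> fg; congr (_ +i* _)%C; apply: eq_Rintegral => x Dx; rewrite fg.
Qed.

Lemma L20 D : measurable D -> L2 D (0 : fn R).
Proof.
move=> mD; split; try exact: measurable_cst.
rewrite (_ : (fun x => _) = cst 0%E); first exact: integrable0.
by apply/funext => x /=; rewrite expr0n addr0.
Qed.

Lemma opI0 D v : opI D (0 : fn R) v = 0.
Proof.
rewrite /opI /cintegral.
under eq_Rintegral do rewrite mul0r.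
under [X in (_ +i* X)%C]eq_Rintegral do rewrite mul0r.
by rewrite /Rintegral integral0.
Qed.

Lemma opI_sum (I : Type) (s : seq I) (F : I -> fn R) D v : measurable D ->
  L2 D v -> (forall i, L2 D (F i)) ->
  opI D (\sum_(i <- s) F i) v = \sum_(i <- s) opI D (F i) v.
Proof.
move=> mD v2 F2.
(* Membership of the partial sums in [L2 D] is carried through the induction, because [opID] asks
   for it. *)
suff [] : L2 D (\sum_(i <- s) F i) /\
  opI D (\sum_(i <- s) F i) v = \sum_(i <- s) opI D (F i) v by [].
elim: s => [|i s [IH2 IH]]; rewrite ?big_nil ?big_cons; split => //.
- exact: L20.
- exact: opI0.
- exact: L2D.
- by rewrite opID// IH.
Qed.

Lemma L2_restrict D E f : measurable D -> measurable E ->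
  L2 D f -> L2 D (fun x => (\1_E x)%:C%C * f x).
Proof.
move=> mD mE [mr mi int].
have ReZ x : complex.Re ((\1_E x)%:C%C * f x) = \1_E x * complex.Re (f x).
  by case: (f x) => a b /=; ring.
have ImZ x : complex.Im ((\1_E x)%:C%C * f x) = \1_E x * complex.Im (f x).
  by case: (f x) => a b /=; ring.
have m1 : measurable_fun D (\1_E : plane R -> R).
  exact/measurable_funTS/measurable_indic.
have mr1 : measurable_fun D (fun x => complex.Re ((\1_E x)%:C%C * f x)).
  by under eq_fun do rewrite ReZ; apply: measurable_funM.
have mi1 : measurable_fun D (fun x => complex.Im ((\1_E x)%:C%C * f x)).
  by under eq_fun do rewrite ImZ; apply: measurable_funM.
split=> //; apply: (le_integrable mD _ _ int).
  apply/measurable_EFinP.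
  by apply: measurable_funD; apply: measurable_funX.
move=> x _ /=; rewrite lee_fin ReZ ImZ !indicE.
by case: (x \in E); rewrite ?mul1r// !mul0r expr0n/= addr0 normr0.
Qed.

End L2.

(** * The diagonal matrix A and its resolvent *)

Section Matrices.
Variables (R : realType) (L : nat) (xi eta : 'I_L -> R) (lam : R).
Implicit Type E : lmodType R[i].

Lemma mxact_diag E (d : 'rV[R]_L) (x : 'I_L -> E) l :
  mxact (diag_mx d) x l = (d 0 l)%:C%C *: x l.
Proof.
rewrite /mxact (bigD1 l)//= mxE eqxx mulr1n big1 ?addr0// => j jl.
by rewrite mxE eq_sym (negbTE jl) scale0r.
Qed.

Lemma bmulE E (w : E) l : bmul xi eta w l = (xi l * eta l)%:C%C *: w.
Proof. by rewrite /bmul /mxact big_ord1 mxE. Qed.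

Hypothesis lamP : forall l, lam != eta l ^+ 2.

(** By [lamP] the diagonal entries of A - lam I are nonzero, and a one-sided inverse of a square
    matrix is its inverse. *)
Lemma invmx_Amx :
  invmx (Amx eta - lam%:M) = diag_mx (\row_l (eta l ^+ 2 - lam)^-1).
Proof.
have AB : (Amx eta - lam%:M) *m diag_mx (\row_l (eta l ^+ 2 - lam)^-1) = 1%:M.
  rewrite -!diag_const_mx -linearB mulmx_diag; congr diag_mx.
  by apply/rowP => l; rewrite !mxE mulfV// subr_eq0 eq_sym.
have [uA _] := mulmx1_unit AB.
by rewrite -[LHS]mulmx1 -AB mulKmx.
Qed.

(** The second factor of each term is kept apart: it is the coefficient of w in x_l. *)
Lemma rational_coefE : rational_coef xi eta lam =
  \sum_l xi l * eta l * (xi l * eta l / (eta l ^+ 2 - lam)).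
Proof.
rewrite /rational_coef invmx_Amx -mulmxA mxE; apply: eq_bigr => l _.
rewrite mul_diag_mx !mxE; ring.
Qed.

End Matrices.

(** * The space X and its scalar product over [Omega2] *)

Section Equivalence.
Variables (R : realType) (a1 a2 : R * R) (Omega1 Omega2 : set (plane R)).
Hypotheses (mOmega1 : measurable Omega1) (mOmega2 : measurable Omega2).
Hypothesis cover : wigner_seitz a1 a2 = Omega1 `|` Omega2.
Hypothesis disjoint : Omega1 `&` Omega2 = set0.

Let Omega : set (plane R) := wigner_seitz a1 a2.
Let X := Xspace a1 a2 Omega1.

(** Measurability of the cell is read off its decomposition, not its geometry. *)
Let mOmega : measurable Omega.
Proof. by rewrite /Omega cover; exact: measurableU. Qed.

Let sub2 : Omega2 `<=` Omega.
Proof. by rewrite /Omega cover; exact: subsetUr. Qed.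

Let L2_Omega2 f : L2 Omega f -> L2 Omega2 f.
Proof. exact: L2_subset. Qed.

Lemma XspaceZ (c : R) f : X f -> X (c%:C%C *: f).
Proof.
move=> [f2 f0]; split; first exact: L2Z.
by apply: filterS f0 => x /= f0 O1; rewrite fctE f0// scaler0.
Qed.

Lemma XspaceD f g : X f -> X g -> X (f + g).
Proof.
move=> [f2 f0] [g2 g0]; split; first exact: L2D.
by apply: filterS2 f0 g0 => x /= f0 g0 O1; rewrite fctE f0// g0// addr0.
Qed.

(** On [Omega1] f vanishes by membership in X, on [Omega2] by definiteness of the form. *)
Lemma Xspace_eq0 f : X f -> opI Omega2 f f = 0 ->
  ae_eq (leb2 R) Omega f (0 : fn R).
Proof.
move=> [/L2_Omega2 f2 f0] /(opI_self_eq0 mOmega2 f2); apply: filterS2 f0 => x /=.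
by rewrite /Omega cover => f1 f2x [].
Qed.

(** This is the uniqueness half of the Riesz isomorphism: the difference h = f - g lies in X and can
    be tested against itself. *)
Lemma Xspace_ae_eq f g : X f -> X g ->
  (forall v, X v -> opI Omega2 f v = opI Omega2 g v) ->
  ae_eq (leb2 R) Omega f g.
Proof.
move=> Xf Xg fg; pose h : fn R := f + (-1)%:C%C *: g.
have Xg' : X ((-1)%:C%C *: g) by exact: XspaceZ.
have Xh : X h by exact: XspaceD.
have L2X u : X u -> L2 Omega2 u by case=> /L2_Omega2.
have : opI Omega2 h h = 0.
  rewrite opID ?opIZ//; try exact: L2X.
  by rewrite fg// rmorphN1 mulN1r subrr.
move=> /(Xspace_eq0 Xh); apply: filterS => x /= h0 Ox.
by have := h0 Ox; rewrite /h fctE rmorphN1 scaleN1r => /eqP; rewrite subr_eq0 => /eqP.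
Qed.

(** * Identification of w with chi_2 u *)

Section Elimination.
Variable u : fn R.
Hypothesis u2 : L2 Omega u.

Let chi2u : fn R := fun x => (\1_Omega2 x)%:C%C * u x.

Let w := jXinv a1 a2 Omega1 Omega2 (opIbar_adj Omega2 u).

Lemma restrict_Xspace : X chi2u.
Proof.
split; first exact: L2_restrict.
apply: aeW => x /= O1; rewrite /chi2u indicE memNset ?mul0r// => O2.
by have : (Omega1 `&` Omega2) x by []; rewrite disjoint.
Qed.

(** The default 0 of [xget] is ruled out by a witness: [chi2u] lies in X and solves the defining
    equation by mere unfolding. *)
Lemma jXinv_adjP :
  X w /\ eq_dual X (jX Omega2 w) (opIbar_adj Omega2 u).
Proof.
apply: (@xgetPex _ 0 [set w | X w /\
  eq_dual X (jX Omega2 w) (opIbar_adj Omega2 u)]).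
by exists chi2u; split; first exact: restrict_Xspace.
Qed.

Lemma opIbar_adjE v : opIbar_adj Omega2 u v = opI Omega2 u v.
Proof.
by apply: opI_eq => x O2; rewrite indicE O2 mul1r.
Qed.

(** The definition of w only controls pairings with X, whereas the first equation is tested on V. So
    w is first identified almost everywhere with [chi2u], and then paired with an arbitrary v. *)
Lemma opI_jXinv_adj v : L2 Omega v -> opI Omega2 w v = opI Omega2 u v.
Proof.
move=> v2; have [Xw wE] := jXinv_adjP.
have wu : ae_eq (leb2 R) Omega w chi2u.
  by apply: Xspace_ae_eq => //; exact: restrict_Xspace.
rewrite -opIbar_adjE; apply: opI_ae_eq => //; try apply: L2_Omega2 => //.
- exact: ae_eq_subset wu.
- by case: Xw.
- exact: L2_restrict.
Qed.

End Elimination.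

(** * Elimination of x from the two rows of (L) *)

Section Problems.
Variables (alpha1 alpha2 : R) (L : nat) (xi eta : 'I_L -> R).
Variables (k : R * R) (lam : R).
Hypothesis lamP : forall l, lam != eta l ^+ 2.

Let V := H1per a1 a2.
Let c l := xi l * eta l / (eta l ^+ 2 - lam).

Let etalam l : eta l ^+ 2 - lam != 0.
Proof. by rewrite subr_eq0 eq_sym. Qed.

(** The resolvent is diagonal, so the components decouple into multiples of the single function
    w. *)
Lemma xformulaE u l :
  xformula a1 a2 Omega1 Omega2 xi eta lam u l =
  (c l)%:C%C *: jXinv a1 a2 Omega1 Omega2 (opIbar_adj Omega2 u).
Proof.
by rewrite /xformula invmx_Amx// mxact_diag bmulE scalerA mxE -rmorphM mulrC.
Qed.

Lemma xformula_Xspace u l : L2 Omega u ->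
  X (xformula a1 a2 Omega1 Omega2 xi eta lam u l).
Proof.
by move=> u2; rewrite xformulaE; apply: XspaceZ; case: (jXinv_adjP u2).
Qed.

Lemma opI_xformula u l v : L2 Omega u -> L2 Omega v ->
  opI Omega2 (xformula a1 a2 Omega1 Omega2 xi eta lam u l) v =
  (c l)%:C%C * opI Omega2 u v.
Proof.
move=> u2 v2; rewrite xformulaE opIZ//; try exact: L2_Omega2.
  by rewrite opI_jXinv_adj.
by apply: L2_Omega2; case: (jXinv_adjP u2) => -[].
Qed.

(** For each test function v the row is a scalar equation that determines (x_l, v)_X, and these
    pairings determine x_l almost everywhere. *)
Lemma blockL_snd_iff u x l : L2 Omega u -> X (x l) ->
  eq_dual X ((blockL a1 a2 Omega2 xi eta k (u, x)).2 l)
    (lam%:C%C *: (massL Omega1 Omega2 alpha1 alpha2 (u, x)).2 l) <->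
  ae_eq (leb2 R) Omega (x l) (xformula a1 a2 Omega1 Omega2 xi eta lam u l).
Proof.
move=> u2 Xx; have Xf := xformula_Xspace l u2.
suff rowE v : X v ->
    ((blockL a1 a2 Omega2 xi eta k (u, x)).2 l v =
     (lam%:C%C *: (massL Omega1 Omega2 alpha1 alpha2 (u, x)).2 l) v <->
     opI Omega2 (x l) v =
     opI Omega2 (xformula a1 a2 Omega1 Omega2 xi eta lam u l) v).
  split=> [eqL|xf v Xv].
    by apply: Xspace_ae_eq => // v Xv; apply/rowE => //; exact: eqL.
  apply/rowE => //; apply: opI_ae_eq => //; first exact: ae_eq_subset xf.
  - by apply: L2_Omega2; case: Xx.
  - by apply: L2_Omega2; case: Xf.
  - by apply: L2_Omega2; case: Xv.
move=> Xv; rewrite opI_xformula//; last by case: Xv.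
have -> : (blockL a1 a2 Omega2 xi eta k (u, x)).2 l v =
    - ((xi l * eta l)%:C%C * opI Omega2 u v) +
    (eta l ^+ 2)%:C%C * opI Omega2 (x l) v.
  transitivity (- (bmul xi eta (opIbar_adj Omega2 u) l v) +
    mxact (Amx eta) (fun l => jX Omega2 (x l)) l v) => //.
  by rewrite bmulE mxact_diag mxE -opIbar_adjE.
have -> : (lam%:C%C *: (massL Omega1 Omega2 alpha1 alpha2 (u, x)).2 l) v =
    lam%:C%C * opI Omega2 (x l) v.
  transitivity (lam%:C%C * mxact 1%:M (fun l => jX Omega2 (x l)) l v) => //.
  by rewrite -diag_const_mx mxact_diag mxE scale1r.
set p := opI _ u v; set q := opI _ (x l) v.
have nz : (eta l ^+ 2 - lam)%:C%C != 0 by rewrite fmorph_eq0.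
have -> : (c l)%:C%C = (xi l * eta l)%:C%C / (eta l ^+ 2 - lam)%:C%C.
  by rewrite /c rmorphM fmorphV.
(* With b = xi_l eta_l and d = eta_l^2 - lam, the row - b p + eta_l^2 q = lam q must be matched with
   q = b p / d. One direction multiplies by d, the other substitutes q. *)
rewrite mulrAC; split=> [E|->].
  apply/(mulIf nz); rewrite mulfVK// rmorphB/=.
  by rewrite mulrC mulrBl -E; ring.
apply/eqP; rewrite eq_sym -subr_eq0; apply/eqP.
transitivity ((xi l * eta l)%:C%C * p - (xi l * eta l)%:C%C * p /
  (eta l ^+ 2 - lam)%:C%C * (eta l ^+ 2 - lam)%:C%C).
  by rewrite [X in _ = _ - _ * X]rmorphB/=; ring.
by rewrite mulfVK// subrr.
Qed.

(** For such x the coupling term Ibar_2 b^* x acts on V as the rational coefficient times I_2 u.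
    Moving it across the equality exchanges the two equations. *)
Lemma blockL_fst_iff u x : L2 Omega u -> (forall l, X (x l)) ->
  (forall l, ae_eq (leb2 R) Omega (x l)
     (xformula a1 a2 Omega1 Omega2 xi eta lam u l)) ->
  eq_dual V (blockL a1 a2 Omega2 xi eta k (u, x)).1
    (lam%:C%C *: (massL Omega1 Omega2 alpha1 alpha2 (u, x)).1) <->
  eq_dual V (opA a1 a2 k u + (Xi xi)%:C%C *: opI Omega2 u)
    (lam%:C%C *: opIalpha Omega1 Omega2 alpha1 alpha2 u +
     (rational_coef xi eta lam)%:C%C *: opI Omega2 u).
Proof.
move=> u2 Xx xf.
have bE v : V v -> opIbar Omega2 (bstar xi eta x) v =
    (rational_coef xi eta lam)%:C%C * opI Omega2 u v.
  move=> [v2 _]; rewrite /opIbar -/(opI Omega2 _ _).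
  have x2 l : L2 Omega2 (x l) by apply: L2_Omega2; case: (Xx l).
  rewrite opI_sum//; [|exact: L2_Omega2|by move=> l; exact: L2Z].
  rewrite rational_coefE// rmorph_sum mulr_suml; apply: eq_bigr => l _.
  rewrite opIZ//; last exact: L2_Omega2.
  rewrite !mxE -/(c l) [in RHS]rmorphM -[RHS]mulrA; congr (_ * _).
  (* Only the class of x_l modulo null sets is known, which is all the integral sees. *)
  rewrite -opI_xformula//.
  apply: opI_ae_eq => //; last exact: L2_Omega2; first exact: ae_eq_subset (xf l).
  by apply: L2_Omega2; case: (xformula_Xspace l u2).
have blockE v : V v -> (blockL a1 a2 Omega2 xi eta k (u, x)).1 v =
    (opA a1 a2 k u + (Xi xi)%:C%C *: opI Omega2 u) v -
    (rational_coef xi eta lam)%:C%C * opI Omega2 u v.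
  by move=> Vv; rewrite -bE.
have sumE v : (lam%:C%C *: opIalpha Omega1 Omega2 alpha1 alpha2 u +
      (rational_coef xi eta lam)%:C%C *: opI Omega2 u) v =
    (lam%:C%C *: opIalpha Omega1 Omega2 alpha1 alpha2 u) v +
    (rational_coef xi eta lam)%:C%C * opI Omega2 u v by [].
split=> E v Vv.
  apply/eqP; rewrite sumE -subr_eq -blockE//; apply/eqP; exact: E.
by apply/eqP; rewrite blockE// subr_eq -sumE; apply/eqP; exact: E.
Qed.

(** Here x_l paired with itself is a multiple of (u, x_l) over [Omega2], hence 0. This excludes
    eigenvectors of (L) with u = 0. *)
Lemma ae_eq0_xformula u l : L2 Omega u -> ae_eq (leb2 R) Omega u (0 : fn R) ->
  ae_eq (leb2 R) Omega (xformula a1 a2 Omega1 Omega2 xi eta lam u l) (0 : fn R).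
Proof.
move=> u2 u0; have Xf := xformula_Xspace l u2; have [f2 _] := Xf.
apply: Xspace_eq0 => //; rewrite opI_xformula// (_ : opI Omega2 u _ = 0) ?mulr0//.
rewrite -[RHS](opI0 Omega2 (xformula a1 a2 Omega1 Omega2 xi eta lam u l)).
apply: opI_ae_eq => //; try exact: L2_Omega2; first exact: ae_eq_subset u0.
exact: L20.
Qed.

End Problems.
End Equivalence.

Theorem lemma4p6 (R : realType) (a1 a2 : R * R) (Omega1 Omega2 : set (R * R))
    (alpha1 alpha2 : R) (L : nat) (xi eta : 'I_L -> R) (k : R * R) (lam : R)
    (basis : a1.1 * a2.2 - a1.2 * a2.1 != 0)
    (mOmega1 : measurable (Omega1 : set (plane R)))
    (mOmega2 : measurable (Omega2 : set (plane R)))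
    (cover : wigner_seitz a1 a2 = Omega1 `|` Omega2)
    (disjoint : Omega1 `&` Omega2 = set0)
    (alpha1_gt0 : 0 < alpha1) (alpha2_gt0 : 0 < alpha2)
    (lamP : forall l, lam != eta l ^+ 2) :
  (forall u : fn R,
     eigenpairN a1 a2 Omega1 Omega2 alpha1 alpha2 xi eta k u lam ->
     eigenpairL a1 a2 Omega1 Omega2 alpha1 alpha2 xi eta k
       (u, xformula a1 a2 Omega1 Omega2 xi eta lam u) lam) /\
  (forall (u : fn R) (x : 'I_L -> fn R),
     eigenpairL a1 a2 Omega1 Omega2 alpha1 alpha2 xi eta k (u, x) lam ->
     (forall l, ae_eq (leb2 R) (wigner_seitz a1 a2) (x l)
                  (xformula a1 a2 Omega1 Omega2 xi eta lam u l)) /\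
     eigenpairN a1 a2 Omega1 Omega2 alpha1 alpha2 xi eta k u lam).
Proof.
split=> [u [Vu un0 EN]|u x [[Vu Xx] z0 E1 E2]]; have [u2 _] := Vu.
- have Xf l := xformula_Xspace mOmega1 mOmega2 cover disjoint xi lamP l u2.
  split.
  + by split=> // l; exact: Xf.
  + by case=> u0 _; exact: un0 u0.
  (* Here x is the formula itself, so the almost-everywhere hypothesis is reflexivity. *)
  + by apply/blockL_fst_iff => // l; exact: aeW.
  + by move=> l; apply/blockL_snd_iff => //; exact: aeW.
- have xf l : ae_eq (leb2 R) (wigner_seitz a1 a2) (x l)
      (xformula a1 a2 Omega1 Omega2 xi eta lam u l).
    by apply/blockL_snd_iff => //; exact: E2.
  split=> //; split=> //.
  (* If u were 0, the formula would make every x_l zero as well, against z being nonzero. *)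
  + move=> u0; apply: z0; split=> // l; apply: ae_eq_trans (xf l) _.
    exact: ae_eq0_xformula.
  + by apply/blockL_fst_iff => //; exact: E1.
Qed.
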